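(* Let $k\ge 2$ be a constant. Let $T$ be a rooted tree of height $h\le k$ with $n$ vertices whose set of leaves $L$ consists of vertices all at depth $h$. Let $F$ be a bipartite graph with parts $L$ and a set $W$ (disjoint from $V(T)$) of at most $n$ vertices, and let $G=T\cup F$. Then there is an algorithm that, in time $O(e(F)\log n+n)$, computes a set $X$ of at least $e(F)/k-O(k^2(|L|+|W|))$ pairs of the form $(uv,C)$, where $uv\in E(F)$ and $C\subseteq G$ is a cycle of length $2k$ containing the edge $uv$.
   Context: $e(F)$ denotes the number of edges of $F$. The depth of a vertex in a rooted tree is its distance from the root.
   Formalization: The height condition h ≤ k is replaced by h < k: for h = k the claim fails, e.g. when T is a spider with all legs of length k and F is dense with girth greater than 2k, so that G has no cycle of length 2k. *)

(* Defs.v *)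
From mathcomp Require Import all_boot all_order all_algebra.

Set Implicit Arguments.
Unset Strict Implicit.
Unset Printing Implicit Defensive.

(** * Word RAM *)

(* A unit-cost random access machine with words of [b] bits: finitely many
   registers per program, a memory indexed by words (all cells start at 0), a
   read-only input tape and a write-only output tape. Programs are structured
   commands whose text is independent of [b]; every node of an expression, every
   command and every evaluation of a guard costs one step. *)

Inductive binop := Add | Sub | Mul | Div | Mod | Eq | Lt.

Inductive expr :=
  | Cst of nat
  | Reg of nat
  | Mem of expr
  | Bin of binop & expr & expr.

Inductive cmd :=
  | Skip
  | Assign of nat & expr
  | Store of expr & expr
  | Input of nat
  | Output of expr
  | Seq of cmd & cmd
  | If of expr & cmd & cmd
  | While of expr & cmd.

Record state := State {
  regs : nat -> nat;
  mem : nat -> nat;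
  input : seq nat;
  output : seq nat
}.

Definition upd (f : nat -> nat) (a v : nat) : nat -> nat :=
  fun x => if x == a then v else f x.

Definition init_state (inp : seq nat) : state :=
  State (fun _ => 0) (fun _ => 0) inp [::].

Definition word (b x : nat) : nat := x %% 2 ^ b.

(* [Sub] is truncated at 0, division by 0 gives 0, and x mod 0 is x. *)
Definition eval_binop (o : binop) (x y : nat) : nat :=
  match o with
  | Add => x + y
  | Sub => x - y
  | Mul => x * y
  | Div => x %/ y
  | Mod => x %% y
  | Eq => x == y
  | Lt => x < y
  end.

Fixpoint eval (b : nat) (s : state) (e : expr) : nat :=
  match e with
  | Cst c => word b c
  | Reg i => regs s i
  | Mem e1 => mem s (eval b s e1)
  | Bin o e1 e2 => word b (eval_binop o (eval b s e1) (eval b s e2))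
  end.

Fixpoint cost (e : expr) : nat :=
  match e with
  | Cst _ | Reg _ => 1
  | Mem e1 => (cost e1).+1
  | Bin _ e1 e2 => (cost e1 + cost e2).+1
  end.

(* [exec b p s s' t]: with [b]-bit words, [p] started in state [s] halts in
   state [s'] after [t] steps. Reading past the end of the input gives 0. *)
Inductive exec (b : nat) : cmd -> state -> state -> nat -> Prop :=
  | exec_skip s : exec b Skip s s 1
  | exec_assign i e s :
      exec b (Assign i e) s
        (State (upd (regs s) i (eval b s e)) (mem s) (input s) (output s))
        (cost e).+1
  | exec_store e1 e2 s :
      exec b (Store e1 e2) s
        (State (regs s) (upd (mem s) (eval b s e1) (eval b s e2))
           (input s) (output s))
        (cost e1 + cost e2).+1
  | exec_input i s :
      exec b (Input i) s
        (State (upd (regs s) i (word b (head 0 (input s)))) (mem s)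
           (behead (input s)) (output s))
        1
  | exec_output e s :
      exec b (Output e) s
        (State (regs s) (mem s) (input s) (rcons (output s) (eval b s e)))
        (cost e).+1
  | exec_seq p q s s1 s2 t1 t2 :
      exec b p s s1 t1 -> exec b q s1 s2 t2 ->
      exec b (Seq p q) s s2 (t1 + t2).+1
  | exec_if_true e p q s s1 t :
      eval b s e != 0 -> exec b p s s1 t ->
      exec b (If e p q) s s1 (cost e + t).+1
  | exec_if_false e p q s s1 t :
      eval b s e = 0 -> exec b q s s1 t ->
      exec b (If e p q) s s1 (cost e + t).+1
  | exec_while_true e p s s1 s2 t1 t2 :
      eval b s e != 0 -> exec b p s s1 t1 -> exec b (While e p) s1 s2 t2 ->
      exec b (While e p) s s2 (cost e + t1 + t2).+1
  | exec_while_false e p s :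
      eval b s e = 0 -> exec b (While e p) s s (cost e).+1.

Definition computes (b : nat) (p : cmd) (inp out : seq nat) (t : nat) : Prop :=
  exists2 s, exec b p (init_state inp) s t & output s = out.

(** * Graphs and rooted trees *)

Section Graphs.
Variable V : finType.
Implicit Types (e : rel V) (r x y : V).

(* Graph distance; equal to #|V| when [y] is not reachable from [x]. *)
Definition dist e x y : nat :=
  find (fun d => [exists p : d.-tuple V, path e x p && (last x p == y)])
       (iota 0 #|V|).

Definition is_tree e : Prop :=
  [/\ symmetric e, irreflexive e, (forall x y, connect e x y)
    & (forall c : seq V, cycle e c -> uniq c -> size c <= 2)].

Definition depth e r x : nat := dist e r x.

Definition height e r : nat := \max_(x : V) depth e r x.

Definition child e r x y : bool := e x y && (depth e r y == (depth e r x).+1).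

(* A leaf is a vertex without children, so the root of a tree with at least two
   vertices is not a leaf even if it has degree 1. *)
Definition leaves e r : {set V} := [set x | [forall y, ~~ child e r x y]].

Definition parent e r y : V := odflt r [pick x | child e r x y].

Definition cycle_edges (c : seq V) : {set {set V}} :=
  [set [set x; next c x] | x in c].

(* The cycles of the graph [e] of length [l], as subgraphs: each is given by its
   set of edges, so that rotations and reflections are identified. *)
Definition is_cycle e (l : nat) (C : {set {set V}}) : Prop :=
  2 < l /\
  exists c : seq V, [/\ cycle e c, uniq c, size c = l & C = cycle_edges c].

End Graphs.

(** * The graph [T ∪ F], and its encoding on the tapes *)

Section Union.
Variables n m : nat.
Implicit Types (T : rel 'I_n) (F : {set 'I_n * 'I_m}).

(* The vertices of [T] are on the left and those of [W] on the right. *)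
Definition vertex : Type := ('I_n + 'I_m)%type.

Definition union_graph T F : rel vertex := fun x y =>
  match x, y with
  | inl u, inl v => T u v
  | inl u, inr w => (u, w) \in F
  | inr w, inl u => (u, w) \in F
  | inr _, inr _ => false
  end.

Definition edge_of (f : 'I_n * 'I_m) : {set vertex} := [set inl f.1; inr f.2].

Definition label (x : vertex) : nat :=
  match x with inl u => u | inr w => n + w end.

(* The input consists of the sizes, the tree as a root and an array of parent
   pointers (the root points to itself), and [F] as a list of edges. *)
Definition encode_input T (r : 'I_n) (fs : seq ('I_n * 'I_m)) : seq nat :=
  [:: n; m; size fs; label (inl r)]
  ++ [seq label (inl (parent T r v)) | v <- enum 'I_n]
  ++ flatten [seq [:: label (inl f.1); label (inr f.2)] | f <- fs].

(* A pair (edge, cycle) is output as the two ends of the edge followed by the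
   vertices of the cycle in cyclic order. *)
Definition item : Type := (('I_n * 'I_m) * seq vertex)%type.

Definition encode_item (i : item) : seq nat :=
  [:: label (inl i.1.1); label (inr i.1.2)] ++ map label i.2.

Definition denote_item (i : item) : {set vertex} * {set {set vertex}} :=
  (edge_of i.1, cycle_edges i.2).

(* [out] lists the elements of [X] without repetition; [l] is the common length
   of the cycles, which makes [out] uniquely decodable. *)
Definition lists (l : nat) (out : seq nat)
    (X : {set {set vertex} * {set {set vertex}}}) : Prop :=
  exists s : seq item,
    [/\ out = flatten (map encode_item s),
        all (fun i : item => size i.2 == l) s,
        uniq (map denote_item s)
      & X = [set x in map denote_item s]].

End Union.

(* Main.v *)
Require Import Defs.
From mathcomp Require Import all_boot all_order all_algebra.
From mathcomp Require Import zify.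

Import Order.TTheory GRing.Theory Num.Theory.

Set Implicit Arguments.
Unset Strict Implicit.
Unset Printing Implicit Defensive.

(** The edges [uw] of [F] are handled one at a time. Fix [w], let [f] be its
    first neighbour, and let [g] be a later neighbour whose lowest common
    ancestor [x] with [f] is the highest so far, at distance [j] above the
    leaves; a further edge [uw] gets level [j]. Let [l = k - j], and suppose that
    the edges of level [j] contain a path of length [2l - 2] from [u] to a leaf
    [z] avoiding [w], [f] and [g]. All leaves on it lie below [x]. As [f] and [g]
    lie below different children of [x], one of them, say [a], lies below another
    child of [x] than [z] does. Then [a], [w], [u], the path to [z], and the tree
    path from [z] through [x] back to [a] form a cycle of length [2l + 2j = 2k].

    To have such paths at hand, every vertex owns for each level a sequence of
    tables of [2k] neighbours, alternately on the side of [L] and of [W]. An edge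
    is stored in the first table of its level that is not full. So when an edge
    is stored in table [i], the tables [0, ..., i-1] at its ends are full, and
    from an edge that finds all tables full one can walk greedily down through
    the tables. Every edge either yields a cycle or fills one of the O(k^3)
    memory cells of a vertex of [L] or [W]; hence
    [e(F) <= |X| + O(k^3 (|L| + |W|))], and it remains to divide by [k]. *)

(** * Loop-free programs *)

Fixpoint loop_free (p : cmd) : bool :=
  match p with
  | Seq p q | If _ p q => loop_free p && loop_free q
  | While _ _ => false
  | _ => true
  end.

(** Without loops, execution is a total function, which can be computed by simplification. A [While]
    gets the identity as a default value. *)
Fixpoint run (b : nat) (p : cmd) (s : state) : state :=
  match p with
  | Skip | While _ _ => s
  | Assign i e =>
      State (upd (regs s) i (eval b s e)) (Defs.mem s) (input s) (output s)
  | Store e1 e2 =>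
      State (regs s) (upd (Defs.mem s) (eval b s e1) (eval b s e2))
        (input s) (output s)
  | Input i =>
      State (upd (regs s) i (word b (head 0 (input s)))) (Defs.mem s)
        (behead (input s)) (output s)
  | Output e =>
      State (regs s) (Defs.mem s) (input s) (rcons (output s) (eval b s e))
  | Seq p q => run b q (run b p s)
  | If e p q => if eval b s e != 0 then run b p s else run b q s
  end.

(** The bound depends on the text of the program alone, so for fixed [k] one round of a main loop
    takes constant time. *)
Fixpoint max_time (p : cmd) : nat :=
  match p with
  | Skip | Input _ => 1
  | Assign _ e | Output e => (cost e).+1
  | Store e1 e2 => (cost e1 + cost e2).+1
  | Seq p q => (max_time p + max_time q).+1
  | If e p q => (cost e + maxn (max_time p) (max_time q)).+1
  | While e _ => (cost e).+1
  end.

Lemma exec_run b p s :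
  loop_free p -> exists2 t, exec b p s (run b p s) t & t <= max_time p.
Proof.
elim: p s => [|i e|e1 e2|i|e|p IHp q IHq|e p IHp q IHq|e p IHp] s //=.
- by move=> _; exists 1 => //; constructor.
- by move=> _; exists (cost e).+1 => //; constructor.
- by move=> _; exists (cost e1 + cost e2).+1 => //; constructor.
- by move=> _; exists 1 => //; constructor.
- by move=> _; exists (cost e).+1 => //; constructor.
- case/andP=> lf_p lf_q; have [t1 ex1 le1] := IHp s lf_p.
  have [t2 ex2 le2] := IHq (run b p s) lf_q.
  exists (t1 + t2).+1; first exact: exec_seq ex1 ex2.
  by rewrite ltnS leq_add.
- case/andP=> lf_p lf_q; have [t1 ex1 le1] := IHp s lf_p.
  have [t2 ex2 le2] := IHq s lf_q.
  case: eqVneq => [e0 | nz_e].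
    exists (cost e + t2).+1; first exact: exec_if_false.
    by rewrite ltnS leq_add2l (leq_trans le2) ?leq_maxr.
  exists (cost e + t1).+1; first exact: exec_if_true.
  by rewrite ltnS leq_add2l (leq_trans le1) ?leq_maxl.
Qed.

(** The invariant carries the number of the round, so there are exactly [N] rounds; the guard is
    evaluated once more at the end. *)
Lemma exec_while b g p N (I : nat -> state -> Prop) s :
    loop_free p -> I 0 s ->
    (forall i s, i < N -> I i s -> eval b s g != 0 /\ I i.+1 (run b p s)) ->
    (forall s, I N s -> eval b s g = 0) ->
  exists s' t, [/\ exec b (While g p) s s' t, I N s'
    & t <= N.+1 * (cost g + max_time p).+1].
Proof.
move=> lf_p I0 step stop.
(* Induction on the number [i] of rounds that remain. *)
have loop i s0 : i <= N -> I (N - i) s0 ->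
    exists s' t, [/\ exec b (While g p) s0 s' t, I N s'
      & t <= i.+1 * (cost g + max_time p).+1].
  elim: i s0 => [|i IH] s0 le_iN.
    rewrite subn0 => IN; exists s0, (cost g).+1; split=> //; last lia.
    by apply: exec_while_false; apply: stop.
  move=> Ii; have lt_iN: N - i.+1 < N by lia.
  have [nz_g] := step _ _ lt_iN Ii; rewrite subnSK // => Ii'.
  have [s' [t' [ex' I' le_t']]] := IH _ (ltnW le_iN) Ii'.
  have [t ex_p le_t] := exec_run b s0 lf_p.
  exists s', (cost g + t + t').+1; split=> //; last lia.
  exact: exec_while_true nz_g ex_p ex'.
by apply: loop; rewrite ?subnn.
Qed.

(** * Distances and ancestors *)

Section Dist.
Variables (V : finType) (e : rel V).

Lemma dist_le x p : path e x p -> dist e x (last x p) <= size p.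
Proof.
move=> e_p; rewrite /dist leqNgt; apply/negP => lt_p.
have p_lt: size p < #|V|.
  by apply: leq_trans lt_p _; rewrite -[leqRHS](size_iota 0) find_size.
have := before_find 0 lt_p; rewrite nth_iota // add0n => /existsP[].
by exists (in_tuple p); rewrite /= e_p eqxx.
Qed.

(** A path without repetitions is shorter than [#|V|], so the bounded search in [dist] succeeds. *)
Lemma dist_connect x y :
  connect e x y -> exists p, [/\ path e x p, last x p = y & size p = dist e x y].
Proof.
case/connectP=> p0 e_p0 ->; case/shortenP: e_p0 => p e_p u_p _.
have p_lt: size p < #|V| by have := max_card [in x :: p]; rewrite (card_uniqP u_p).
pose a d := [exists q : d.-tuple V, path e x q && (last x q == last x p)].
have: has a (iota 0 #|V|).
  apply/hasP; exists (size p); first by rewrite mem_iota.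
  by apply/existsP; exists (in_tuple p); rewrite /= e_p eqxx.
move=> hs; have := nth_find 0 hs; rewrite nth_iota; last first.
  by move: hs; rewrite has_find size_iota.
case/existsP=> q /andP[e_q /eqP lq]; exists q; split=> //.
by rewrite size_tuple.
Qed.

Lemma dist0 x : dist e x x = 0.
Proof. by apply/eqP; rewrite -leqn0 (@dist_le x [::]). Qed.

Lemma dist_step x y z : connect e x y -> e y z -> dist e x z <= (dist e x y).+1.
Proof.
case/dist_connect=> p [e_p <- <-] e_yz.
by rewrite -(size_rcons p z) -{1}(last_rcons x p z) dist_le // rcons_path e_p.
Qed.

(** The vertex before [y] on a shortest path is one step closer to [x], so the [pick] in [parent]
    cannot fail. *)
Lemma parent_child x y : connect e x y -> 0 < dist e x y ->
  child e x (parent e x y) y.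
Proof.
move=> cxy d_gt0; rewrite /parent; case: pickP => //= nochild.
have [p [e_p lp sp]] := dist_connect cxy.
case/lastP: p => [|p y'] in e_p lp sp; first by rewrite -sp in d_gt0.
rewrite last_rcons in lp; rewrite {y'}lp in e_p sp.
rewrite rcons_path size_rcons in e_p sp; case/andP: e_p => e_p e_y.
have cxz: connect e x (last x p) by apply/connectP; exists p.
have := nochild (last x p); rewrite /child e_y /depth.
by have := dist_le e_p; have := dist_step cxz e_y; rewrite -sp; lia.
Qed.

Lemma parent_root x : parent e x x = x.
Proof.
rewrite /parent; case: pickP => //= z; rewrite /child /depth dist0.
by rewrite andbF.
Qed.

Definition anc r i := iter i (parent e r).

Section Anc.
Variables (r v : V) (h : nat).
Hypothesis conn : forall x y, connect e x y.
Hypothesis depth_v : depth e r v = h.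

Lemma depth_anc i : i <= h -> depth e r (anc r i v) = h - i.
Proof.
elim: i => [|i IH] le_ih; first by rewrite depth_v subn0.
have d_i := IH (ltnW le_ih).
have: child e r (parent e r (anc r i v)) (anc r i v).
  by apply: parent_child; rewrite ?conn // -/(depth e r _) d_i subn_gt0.
by case/andP=> _ /eqP; rewrite d_i /= -/(anc r i v); lia.
Qed.

Lemma edge_anc i : i < h -> e (anc r i.+1 v) (anc r i v).
Proof.
move=> lt_ih; have d_i := depth_anc (ltnW lt_ih).
have: child e r (parent e r (anc r i v)) (anc r i v).
  by apply: parent_child; rewrite ?conn // -/(depth e r _) d_i subn_gt0.
by case/andP.
Qed.

(** [parent] fixes the root, so climbing too far stays there. Hence all leaves share their ancestor
    at level [k.-1], where the search for the level of an edge starts. *)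
Lemma anc_root i : h <= i -> anc r i v = r.
Proof.
move=> le_hi; rewrite -(subnK le_hi) /anc iterD -/(anc r h v).
have -> : anc r h v = r.
  have := depth_anc (leqnn h); rewrite subnn /depth.
  have [p [_ <- <-]] := dist_connect (conn r (anc r h v)).
  by move/size0nil=> ->.
by elim: (i - h) => //= d ->; rewrite parent_root.
Qed.

End Anc.
End Dist.

(** * The program *)

Section Program.
Variable k : nat.

(* The slots of level [j] are numbered consecutively: slot [q] lies in the table
   [q %/ table_size], which is kept at the end in [L] iff its index is odd. *)
Definition table_size := 2 * k.
Definition tables (j : nat) := (k - j.+1).*2.
Definition slots := table_size * table_size.

(* The record of a vertex has the parent at offset 0; for a vertex of [W], the
   first neighbour [f] at offset 1 and the neighbour [g] of level [j] at offset
   [j.+1]; then the slots of all levels. Vertices are stored as their label plus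
   one, so that 0 marks an empty cell. *)
Definition slot (j q : nat) := k.+1 + (j * slots + q).
Definition record_size := k.+1 + k * slots.

Definition addrE (e : expr) (o : nat) : expr :=
  Bin Add (Bin Mul (Cst record_size) e) (Cst o).
Definition cellE e o := Defs.Mem (addrE e o).
Definition ancE i e := iter i (fun e' => cellE e' 0) e.

Definition at_u (q : nat) : bool := odd (q %/ table_size).
(* Register 0 counts the remaining edges, registers 1, 2, 3 hold [w], [f], [g],
   and the walk from [u] occupies the registers from 4 on. *)
Definition here q : nat := if at_u q then 4 else 1.
Definition there q : nat := if at_u q then 1 else 4.

(** The search for an empty slot is unrolled into nested conditionals, [k] being constant; [full] is
    what follows if there is none. *)
Fixpoint insert (j : nat) (full : cmd) (c q : nat) : cmd :=
  match c with
  | 0 => full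
  | c'.+1 =>
      If (cellE (Reg (here q)) (slot j q)) (insert j full c' q.+1)
        (Store (addrE (Reg (here q)) (slot j q)) (Reg (there q)))
  end.

(** The registers compared hold [w], [f], [g] and the walk so far, all of which the next vertex has
    to avoid. *)
Definition usedE (t : nat) (e : expr) : expr :=
  foldr (fun i acc => Bin Add (Bin Eq (Reg i) e) acc) (Cst 0) (iota 1 (4 + t)).

Fixpoint pick_next (j t c q : nat) : cmd :=
  match c with
  | 0 => Skip
  | c'.+1 =>
      If (usedE t (cellE (Reg (4 + t)) (slot j q))) (pick_next j t c' q.+1)
        (Assign (5 + t) (cellE (Reg (4 + t)) (slot j q)))
  end.

(** Here [s] steps remain and [t] have been made. Tables are read in decreasing order, since an edge
    stored in one table guarantees full tables only below it. *)
Fixpoint walk (j s t : nat) : cmd :=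
  match s with
  | 0 => Skip
  | s'.+1 =>
      Seq (pick_next j t table_size (s' * table_size)) (walk j s' t.+1)
  end.

Definition outputs (es : seq expr) : cmd :=
  foldr (fun e c => Seq (Output (Bin Defs.Sub e (Cst 1))) c) Skip es.

(** Register 2 holds [a]. The common ancestor is listed with the climb from [z], so the other climb
    has only the levels up to [j.-1]. *)
Definition cycleE (j : nat) : seq expr :=
  [:: Reg 2; Reg 1] ++ [seq Reg (4 + t) | t <- iota 0 (tables j).+1]
  ++ [seq ancE i (Reg (4 + tables j)) | i <- iota 1 j]
  ++ [seq ancE i (Reg 2) | i <- rev (iota 1 j.-1)].

(** The test tells whether [z] and [f] lie below the same child of [x]; if so, [g] becomes [a] in
    place of [f]. *)
Definition report (j : nat) : cmd :=
  Seq (If (Bin Eq (ancE j.-1 (Reg (4 + tables j))) (ancE j.-1 (Reg 2)))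
         (Assign 2 (Reg 3)) Skip)
      (outputs ([:: Reg 4; Reg 1] ++ cycleE j)).

(** Levels are tried from the top, and on entry [u] and [f] have the same ancestor at level [j]. If
    level [j] has no [g] and the ancestors one level below differ, then [u] becomes this [g]. *)
Fixpoint dispatch (j : nat) : cmd :=
  match j with
  | 0 => Skip
  | j'.+1 =>
      If (cellE (Reg 1) j.+1)
        (Seq (Assign 3 (cellE (Reg 1) j.+1))
           (insert j (Seq (walk j (tables j) 0) (report j))
              (tables j * table_size) 0))
        (If (Bin Eq (ancE j' (Reg 4)) (ancE j' (Reg 2))) (dispatch j')
           (Store (addrE (Reg 1) j.+1) (Reg 4)))
  end.

Definition read_id i : cmd := Seq (Input i) (Assign i (Bin Add (Reg i) (Cst 1))).

Definition edge_step : cmd :=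
  Seq (read_id 4) (Seq (read_id 1)
  (Seq (If (cellE (Reg 1) 1) (Seq (Assign 2 (cellE (Reg 1) 1)) (dispatch k.-1))
          (Store (addrE (Reg 1) 1) (Reg 4)))
       (Assign 0 (Bin Defs.Sub (Reg 0) (Cst 1))))).

(** Register 1 holds [n] and register 2 counts the vertices; it is increased before the store
    because identifiers are labels plus one. *)
Definition parent_step : cmd :=
  Seq (read_id 3) (Seq (Assign 2 (Bin Add (Reg 2) (Cst 1)))
    (Store (addrE (Reg 2) 0) (Reg 3))).

Definition prologue : cmd :=
  Seq (Input 1) (Seq (Input 2) (Seq (Input 0) (Seq (Input 2) (Assign 2 (Cst 0))))).

Definition cycle_finder : cmd :=
  Seq prologue (Seq (While (Bin Lt (Reg 2) (Reg 1)) parent_step)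
                    (While (Reg 0) edge_step)).

Lemma slot_lt j q : j < k -> q < slots -> slot j q < record_size.
Proof. by rewrite /slot /record_size; nia. Qed.

Lemma slot_inj j q j' q' : q < slots -> q' < slots ->
  slot j q = slot j' q' -> j = j' /\ q = q'.
Proof.
move=> lt_q lt_q' /addnI E; have nz : 0 < slots by lia.
have := congr1 (divn^~ slots) E; rewrite !divnMDl // !divn_small // !addn0.
by move=> Ej; split=> //; move: E; rewrite Ej => /addnI.
Qed.

Lemma table_slots j q : q < tables j * table_size -> q < slots.
Proof.
move=> lt_q; apply: leq_trans lt_q _; rewrite leq_mul2r /tables /table_size.
by apply/orP; right; lia.
Qed.

Lemma loop_free_outputs es : loop_free (outputs es).
Proof. by elim: es. Qed.

Lemma loop_free_insert j full c q :
  loop_free full -> loop_free (insert j full c q).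
Proof. by move=> lf; elim: c q => //= c IH q; rewrite IH. Qed.

Lemma loop_free_pick_next j t c q : loop_free (pick_next j t c q).
Proof. by elim: c q => //= c IH q; rewrite IH. Qed.

Lemma loop_free_walk j s t : loop_free (walk j s t).
Proof. by elim: s t => //= s IH t; rewrite IH loop_free_pick_next. Qed.

Lemma loop_free_dispatch j : loop_free (dispatch j).
Proof.
elim: j => //= j ->; rewrite loop_free_insert //=.
by rewrite loop_free_walk loop_free_outputs.
Qed.

Lemma loop_free_edge_step : loop_free edge_step.
Proof. by rewrite /edge_step /= loop_free_dispatch. Qed.

End Program.

(** * Vertices in memory *)

Section Memory.
Variables (k n m b : nat).
Local Notation B := (record_size k).
Implicit Types (x y : vertex n m) (M : nat -> nat) (s : state).

Definition ident x := (label x).+1.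
Definition cell M x o := M (B * ident x + o).

Lemma ident_le x : ident x <= n + m.
Proof. by case: x => [[u ltu]|[w ltw]]; rewrite /ident /=; lia. Qed.

Lemma label_inj : injective (@label n m).
Proof.
move=> [u|w] [u'|w'] /=; have := ltn_ord; move=> lt E.
- by congr inl; apply: val_inj.
- by have := lt _ u; lia.
- by have := lt _ u'; lia.
- by congr inr; apply: val_inj; apply: addnI E.
Qed.

Lemma ident_inj : injective ident.
Proof. by move=> x y [] /label_inj. Qed.

(** Division by [B] with remainder recovers the identifier and the offset. *)
Lemma addr_inj x y o o' : o < B -> o' < B ->
  (B * ident x + o == B * ident y + o') = (x == y) && (o == o').
Proof.
move=> lt_o lt_o'; have B_gt0: 0 < B by lia.
apply/eqP/andP => [E|[/eqP-> /eqP->] //].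
have := congr1 (divn^~ B) E; have := congr1 (modn^~ B) E.
rewrite ![B * _]mulnC !modnMDl !divnMDl // !divn_small // !modn_small //.
by rewrite !addn0 => -> /ident_inj ->; rewrite !eqxx.
Qed.

Lemma cell_upd M x o y o' v : o < B -> o' < B ->
  cell (upd M (B * ident x + o) v) y o'
    = if (y == x) && (o' == o) then v else cell M y o'.
Proof. by move=> lt_o lt_o'; rewrite /cell /upd addr_inj. Qed.

Lemma word_small (a : nat) : a < 2 ^ b -> word b a = a.
Proof. exact: modn_small. Qed.

Hypothesis word_large : B * (n + m).+1 <= 2 ^ b.

(** Identifiers are at most [n + m], so every record ends below [B * (n + m).+1] and no address
    wraps around. *)
Lemma addr_lt x o : o < B -> B * ident x + o < 2 ^ b.
Proof.
move=> lt_o; apply: leq_trans word_large; rewrite mulnS.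
by have := ident_le x; nia.
Qed.

Lemma eval_addr s e o x : eval b s e = ident x -> o < B ->
  eval b s (addrE k e o) = B * ident x + o.
Proof.
move=> E lt_o; have := addr_lt x lt_o => lt; rewrite /= E.
rewrite [word b o]word_small; last by lia.
rewrite [word b B]word_small; last first.
  by apply: leq_trans word_large; rewrite mulnS; move: lt_o (ident_le x);
     rewrite /ident; nia.
by rewrite [word b (B * _)]word_small ?word_small //; lia.
Qed.

Lemma eval_cell s e o x : eval b s e = ident x -> o < B ->
  eval b s (cellE k e o) = cell (Defs.mem s) x o.
Proof. by move=> E lt_o; rewrite /cell -(eval_addr E lt_o). Qed.

Lemma eval_anc T r s e u i :
    0 < B ->
    (forall u', cell (Defs.mem s) (inl u') 0 = ident (inl (parent T r u'))) ->
    eval b s e = ident (inl u) ->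
  eval b s (ancE k i e) = ident (inl (anc T r i u)).
Proof.
move=> B_gt0 par E; elim: i => // i IH.
by rewrite [ancE k i.+1 e]/= (eval_cell IH).
Qed.

(** Expressions do not read the tapes, so those still to be printed keep their values while the
    output grows. *)
Lemma eval_io R M I O I' O' e :
  eval b (State R M I O) e = eval b (State R M I' O') e.
Proof. by elim: e => //= [e ->|o e1 -> e2 ->]. Qed.

Lemma run_outputs s es (xs : seq (vertex n m)) :
    1 < 2 ^ b ->
    map (eval b s) es = map ident xs ->
  run b (outputs es) s
    = State (regs s) (Defs.mem s) (input s) (output s ++ map (@label n m) xs).
Proof.
move=> b_gt; elim: es xs s => [|e es IH] [|x xs] [R M I O] //=; first by rewrite cats0.
case=> Ee Ees; rewrite (IH xs).
  rewrite /= Ee !word_small //; first by rewrite /ident subn1 /= cat_rcons.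
  have := @addr_lt x 0; have B_gt0 : 0 < B by [].
  by move/(_ B_gt0); rewrite /ident; nia.
by rewrite -Ees; apply: eq_map => e'; apply: eval_io.
Qed.

End Memory.

(** * Closing a path through the tree *)

Section Close.
Variables (n m h : nat) (T : rel 'I_n) (r : 'I_n) (F : {set 'I_n * 'I_m}).
Hypothesis symT : symmetric T.
Hypothesis connT : forall x y, connect T x y.
Local Notation U := (union_graph T F).
Local Notation vtx := (vertex n m).

(** Vertices of [W] are included because a climb in the tree never meets them either. *)
Definition at_bottom (x : vtx) : bool :=
  match x with inl u => depth T r u == h | inr _ => true end.

Definition ascent (v : 'I_n) (i : nat) : vtx := inl (anc T r i v).

Definition close (a : 'I_n) (w : 'I_m) (p : seq vtx) (z : 'I_n) (j : nat) :
    seq vtx :=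
  [:: inl a; inr w] ++ p ++ [seq ascent z i | i <- iota 1 j]
  ++ [seq ascent a i | i <- rev (iota 1 j.-1)].

Lemma size_close a w p z j :
  size (close a w p z j) = size p + (j + j.-1).+2.
Proof.
by rewrite /close !(size_cat, size_map, size_rev, size_iota) /=; lia.
Qed.

Lemma path_ascent v i j : depth T r v = h -> i + j <= h ->
  path U (ascent v i) [seq ascent v l | l <- iota i.+1 j].
Proof.
move=> dv; elim: j i => //= j IH i le_h.
rewrite IH ?addSnnS // andbT symT; apply: (edge_anc connT dv).
by lia.
Qed.

Lemma last_ascent v i j x :
  last x [seq ascent v l | l <- iota i j.+1] = ascent v (i + j).
Proof.
elim: j i x => [|j IH] i x; first by rewrite addn0.
by rewrite addnS -addSn; apply: IH.
Qed.

Lemma belast_ascent v i j :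
  belast (ascent v i) [seq ascent v l | l <- iota i.+1 j]
    = [seq ascent v l | l <- iota i j].
Proof. by elim: j i => //= j IH i; rewrite IH. Qed.

Lemma symU : symmetric U.
Proof. by move=> [u|w] [u'|w'] //=; rewrite symT. Qed.

Section Cycle.
Variables (u a z : 'I_n) (w : 'I_m) (p : seq vtx) (j : nat).
Hypotheses (j_gt0 : 0 < j) (uwF : (u, w) \in F) (awF : (a, w) \in F).
Hypotheses (path_p : path U (inl u) p) (last_p : last (inl u) p = inl z).
Hypothesis uniq_p : uniq [:: inl a, inr w, inl u & p].
Hypothesis bottom_p : all at_bottom [:: inl a, inl u & p].
Hypothesis anc_eq : anc T r j z = anc T r j a.
Hypothesis anc_neq : anc T r j.-1 z != anc T r j.-1 a.

Let bottomP x : x \in inl u :: p -> at_bottom x.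
Proof. by case/and3P: bottom_p => _ bu /allP bp /[1!inE] /predU1P[-> //|/bp]. Qed.

Let depth_a : depth T r a = h.
Proof. by case/andP: bottom_p => /eqP. Qed.

Let depth_z : depth T r z = h.
Proof. by apply/eqP/(@bottomP (inl z)); rewrite -last_p mem_last. Qed.

(** Otherwise both ancestors at level [j.-1] would be the root. *)
Let le_jh : j <= h.
Proof.
rewrite leqNgt; apply: contra anc_neq => lt_hj.
by rewrite (anc_root connT depth_z) ?(anc_root connT depth_a) //; lia.
Qed.

Let ascent_depth v i x : depth T r v = h -> 0 < i <= j -> at_bottom x ->
  ascent v i != x.
Proof.
case: x => //= x dv /andP[i0 le_i] /eqP dx; apply/eqP => -[E].
by move: dx; rewrite -E (depth_anc connT dv); lia.
Qed.

(** The level [i] can be read off from the depth [h - i]. *)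
Let ascent_inj v v' i i' : depth T r v = h -> depth T r v' = h ->
  i <= j -> i' <= j -> ascent v i = ascent v' i' -> i = i'.
Proof.
move=> dv dv' le_i le_i' [E]; have := depth_anc connT dv (leq_trans le_i le_jh).
by rewrite E (depth_anc connT dv'); lia.
Qed.

Lemma cycle_close : cycle U (close a w (inl u :: p) z j).
Proof.
rewrite /close /= awF /= uwF /= !rcons_cat !cat_path path_p last_p /=.
apply/andP; split; first exact: (@path_ascent z 0 j).
rewrite -[X in rcons _ X]/(ascent a 0) -map_rcons.
have -> : last (inl z) [seq ascent z i | i <- iota 1 j] = ascent a j.
  by case: (j) j_gt0 anc_eq => // j' _ E; rewrite last_ascent add1n /ascent E.
(* The descent to [a] is the climb from [a] read backwards. *)
have := @path_ascent a 0 j depth_a le_jh.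
rewrite -(eq_path (e := fun x y => U y x)); last by move=> x y; rewrite symU.
rewrite -rev_path; congr path.
  by case: (j) j_gt0 => // j' _; rewrite last_ascent add1n.
rewrite belast_ascent; case: (j) j_gt0 => // j' _ /=.
by rewrite rev_cons map_rcons map_rev.
Qed.

Lemma uniq_close : uniq (close a w (inl u :: p) z j).
Proof.
rewrite /close (catA _ (inl u :: p)) cat_uniq; apply/andP; split; first exact: uniq_p.
have inj_asc v s : depth T r v = h -> uniq s -> {subset s <= iota 0 j.+1} ->
    uniq [seq ascent v i | i <- s].
  move=> dv us sub; rewrite map_inj_in_uniq // => i i' /sub + /sub.
  by rewrite !mem_iota => lti lti'; apply: ascent_inj.
apply/andP; split.
  apply/hasPn => x; rewrite mem_cat => x_in.
  have [v [i [dv lt_i ->]]] : exists v i, [/\ depth T r v = h, 0 < i <= j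
      & x = ascent v i].
    case/orP: x_in => /mapP[i]; rewrite ?mem_rev mem_iota => lt_i ->.
      by exists z, i; split=> //; lia.
    by exists a, i; split=> //; lia.
  have asc := ascent_depth dv lt_i.
  rewrite !inE /= negb_or (asc (inl a)) /=; last by rewrite depth_a.
  rewrite negb_or (asc (inl u)) /=; last exact: (@bottomP (inl u) (mem_head _ _)).
  apply/negP => in_p; have: at_bottom (ascent v i).
    by apply: bottomP; rewrite inE in_p orbT.
  by move/asc; rewrite eqxx.
rewrite cat_uniq !inj_asc ?rev_uniq ?iota_uniq //.
(* The two climbs could only meet at the same level [i <= j.-1], and then they would also agree at
   level [j.-1], against [anc_neq]. *)
- rewrite andbT; apply/hasPn => x /mapP[i]; rewrite mem_rev mem_iota => lt_i ->.
  apply/mapP => -[i']; rewrite mem_iota => lt_i' E.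
  have Ei : i = i' by apply: ascent_inj E => //; lia.
  move: E; rewrite -{i'}Ei in lt_i' * => -[E].
  case/eqP: anc_neq; rewrite -(@subnK i j.-1); last by lia.
  by rewrite /anc !iterD -!/(anc T r i _) E.
- by move=> i; rewrite mem_rev !mem_iota; lia.
- by move=> i; rewrite !mem_iota; lia.
Qed.

Lemma edge_close : edge_of (u, w) \in cycle_edges (close a w (inl u :: p) z j).
Proof.
apply/imsetP; exists (inr w); first by rewrite !inE eqxx orbT.
by rewrite /close /= eqxx /edge_of /= setUC.
Qed.

End Cycle.
End Close.

(** * The invariant of the main loop *)

Section Invariant.
Variables (k n m b : nat) (T : rel 'I_n) (r : 'I_n).
Local Notation B := (record_size k).
Local Notation edge := ('I_n * 'I_m)%type.
Local Notation vtx := (vertex n m).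
Local Notation anc := (anc T r).
Implicit Types (M : nat -> nat) (x y : vtx) (e : edge) (d : seq edge).

Definition endp q e : vtx := if at_u k q then inl e.1 else inr e.2.
Definition far q e : vtx := if at_u k q then inr e.2 else inl e.1.

(** For [j = 0] this says [u = v]: the vertex [f] at offset 1 counts as the [g] of level 0, so that
    [inv_ref] covers it too. *)
Definition lca_level j (u v : 'I_n) : bool :=
  (anc j u == anc j v) && ((0 < j) ==> (anc j.-1 u != anc j.-1 v)).

Local Notation cell := (@cell k n m).

(** The list [d] consists of the edges already treated. By [inv_slot] every entry comes from an edge
    for which all earlier slots of its level are filled, at whichever end they are kept; by
    [inv_uniq] the entries of a full table are distinct. *)
Record loop_invariant d M : Prop := {
  inv_parent u : cell M (inl u) 0 = ident (inl (parent T r u) : vtx);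
  inv_ref w j : j < k -> cell M (inr w) j.+1 != 0 ->
    exists f g, [/\ cell M (inr w) 1 = ident (inl f : vtx),
      cell M (inr w) j.+1 = ident (inl g : vtx), (f, w) \in d, (g, w) \in d
      & lca_level j g f];
  inv_slot x j q : j < k -> q < slots k -> cell M x (slot k j q) != 0 ->
    exists e f, [/\ x = endp q e, cell M x (slot k j q) = ident (far q e),
      e \in d, cell M (inr e.2) 1 = ident (inl f : vtx) /\ anc j e.1 = anc j f
      & forall q', q' < q -> cell M (endp q' e) (slot k j q') != 0];
  inv_uniq x j q q' : j < k -> q < slots k -> q' < slots k ->
    cell M x (slot k j q) != 0 ->
    cell M x (slot k j q) = cell M x (slot k j q') -> q = q'
}.

Definition write M x o (v : nat) := upd M (B * ident x + o) v.

Lemma cell_write M x o y o' v : o < B -> o' < B ->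
  cell (write M x o v) y o' = if (y == x) && (o' == o) then v else cell M y o'.
Proof. exact: cell_upd. Qed.

(** Edges are written into empty cells only, so what is known about filled cells persists. *)
Lemma cell_keep M x o y o' v : o < B -> o' < B -> cell M x o = 0 ->
  cell M y o' != 0 -> cell (write M x o v) y o' = cell M y o'.
Proof.
move=> lt_o lt_o' E nz; rewrite cell_write //.
by case: ifP => // /andP[/eqP Ey /eqP Eo]; rewrite Ey Eo E in nz.
Qed.

Lemma ref_lt j : j < k -> j.+1 < B.
Proof. by rewrite /record_size; lia. Qed.

Lemma slot_gt j q : k < slot k j q.
Proof. by rewrite /slot; lia. Qed.

Lemma inv_mono d e M : loop_invariant d M -> loop_invariant (e :: d) M.
Proof.
case=> ip ir sl iu; split=> //.
  move=> w j lt_j /(ir _ _ lt_j)[f [g [? ? fd gd ?]]].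
  by exists f, g; split=> //; rewrite inE ?fd ?gd orbT.
move=> x j q lt_j lt_q /(sl _ _ _ lt_j lt_q)[e' [f [? ? ed ? ?]]].
by exists e', f; split=> //; rewrite inE ed orbT.
Qed.

(** The alternatives in [cond] are the first edge at [w], where [u] itself becomes [f], and a later
    edge whose end [u] becomes the [g] of level [j]. *)
Lemma inv_write_ref d M u w j f :
    loop_invariant d M -> j < k -> cell M (inr w) j.+1 = 0 ->
    j = 0 /\ f = u \/ cell M (inr w) 1 = ident (inl f : vtx) /\ (f, w) \in d ->
    lca_level j u f ->
  loop_invariant ((u, w) :: d) (write M (inr w) j.+1 (ident (inl u : vtx))).
Proof.
move=> inv lt_j E0 cond lca; have lt_o := ref_lt lt_j.
have k_gt0 : 0 < k by lia.
have keep y o' : o' < B -> cell M y o' != 0 ->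
    cell (write M (inr w) j.+1 (ident (inl u : vtx))) y o' = cell M y o'.
  by move=> lt_o'; apply: cell_keep.
have other y j' q : j' < k -> q < slots k ->
    cell (write M (inr w) j.+1 (ident (inl u : vtx))) y (slot k j' q)
      = cell M y (slot k j' q).
  move=> lt_j' lt_q; rewrite cell_write ?slot_lt //.
  by have := slot_gt j' q; case: (slot k j' q =P j.+1) => [|_]; rewrite ?andbF //; lia.
case: (inv) => ip ir sl iu; split.
- by move=> v; rewrite cell_write // andbF ip.
- move=> w' j' lt_j'; rewrite cell_write ?ref_lt //.
  case: ifP => [/andP[/eqP[->] /eqP[->]] _ | _ nz].
    exists f, u; rewrite cell_write ?ref_lt // eqxx /=; split=> //.
    + case: cond => [[-> ->]|[E1 _]] //.
      by case: eqP => [[j0]|//]; rewrite -j0 E1 in E0.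
    + by case: cond => [[_ ->]|[_ fd]]; rewrite inE ?eqxx // fd orbT.
    + exact: mem_head.
  have [f' [g' [E1 E2 fd gd lca']]] := ir _ _ lt_j' nz.
  by exists f', g'; rewrite keep ?E1 ?ref_lt // !inE fd gd !orbT.
- move=> x j' q lt_j' lt_q; rewrite other // => nz.
  have [e [f' [-> E ed [E1 ae] prev]]] := sl _ _ _ lt_j' lt_q nz.
  exists e, f'; rewrite keep ?E1 ?ref_lt // inE ed orbT; split=> // q' lt_q'.
  by rewrite other ?prev //; lia.
- move=> x j' q q' lt_j' lt_q lt_q'; rewrite !other //; exact: iu.
Qed.

Lemma inv_write_slot d M e j q f :
    loop_invariant d M -> j < k -> q < slots k -> e \notin d ->
    cell M (endp q e) (slot k j q) = 0 ->
    cell M (inr e.2) 1 = ident (inl f : vtx) -> anc j e.1 = anc j f ->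
    (forall q', q' < q -> cell M (endp q' e) (slot k j q') != 0) ->
  loop_invariant (e :: d) (write M (endp q e) (slot k j q) (ident (far q e))).
Proof.
move=> inv lt_j lt_q e_d E0 E1 ae prev; have lt_o := slot_lt lt_j lt_q.
have k_gt0 : 0 < k by lia.
set v := ident (far q e).
have keep y o' : o' < B -> cell M y o' != 0 ->
    cell (write M (endp q e) (slot k j q) v) y o' = cell M y o'.
  by move=> lt_o'; apply: cell_keep.
have other y o' : o' <= k ->
    cell (write M (endp q e) (slot k j q) v) y o' = cell M y o'.
  move=> le_o'; rewrite cell_write //; last by rewrite /record_size; lia.
  by have := slot_gt j q; case: (o' =P slot k j q) => [|_]; rewrite ?andbF //; lia.
case: (inv) => ip ir sl iu.
(* The owner of a slot, its entry and the parity of its table determine the edge, so an edge outside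
   [d] is not yet stored. *)
have fresh x j' q' : j' < k -> q' < slots k -> x = endp q e ->
    at_u k q' = at_u k q -> cell M x (slot k j' q') != v.
  move=> lt_j' lt_q' -> par; apply/eqP => E.
  have [|e' [f' [Ex Ey ed' _ _]]] := sl (endp q e) j' q' lt_j' lt_q'.
    by rewrite E.
  have Ey' : far q e = far q' e' by apply/ident_inj; rewrite -Ey E.
  suff Ee : e = e' by rewrite Ee ed' in e_d.
  rewrite (surjective_pairing e) (surjective_pairing e'); move: Ex Ey'.
  by rewrite /endp /far par; case: (at_u k q) => -[->] [->].
split.
- by move=> u; rewrite other ?ip.
- move=> w j' lt_j'; rewrite !other // => nz.
  have [f' [g' [? ? fd gd ?]]] := ir _ _ lt_j' nz.
  by exists f', g'; rewrite !inE fd gd !orbT.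
- move=> x j' q' lt_j' lt_q'; rewrite cell_write ?slot_lt //.
  have prevW e' j'' q'' : j'' < k -> q'' < slots k ->
      cell M (endp q'' e') (slot k j'' q'') != 0 ->
      cell (write M (endp q e) (slot k j q) v) (endp q'' e') (slot k j'' q'') != 0.
    by move=> ? ? nz; rewrite keep ?slot_lt.
  case: ifP => [/andP[/eqP-> /eqP Es] _ | _ nz].
    have [-> ->] := slot_inj lt_q' lt_q Es.
    exists e, f; rewrite other // mem_head; split=> // q'' lt_q''.
    by apply: prevW; [| lia | exact: prev].
  have [e' [f' [-> E ed [E1' ae'] prev']]] := sl _ _ _ lt_j' lt_q' nz.
  exists e', f'; rewrite other // inE ed orbT; split=> // q'' lt_q''.
  by apply: prevW; [| lia | exact: prev'].
- move=> x j' q1 q2 lt_j' lt_q1 lt_q2; rewrite !cell_write ?slot_lt //.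
  have slotP x' q' : q' < slots k -> cell M x' (slot k j' q') != 0 ->
      exists e', x' = endp q' e'.
    by move=> lt_q' /(sl _ _ _ lt_j' lt_q')[e' [f' []]]; exists e'.
  (* A filled slot of the other parity would have its owner on the other side, so [fresh]
     suffices. *)
  have v_other q' : q' < slots k -> x = endp q e -> v != cell M x (slot k j' q').
    move=> lt_q' Ex; apply/eqP => Ev; have [|e' E'] := @slotP x q' lt_q'.
      by rewrite -Ev.
    suff par : at_u k q' = at_u k q.
      by move: (fresh x j' q' lt_j' lt_q' Ex par); rewrite Ev eqxx.
    by move: E'; rewrite Ex /endp; case: (at_u k q); case: (at_u k q').
  case: ifP => [/andP[/eqP Ex /eqP Es1] _ | _ nz].
    case: ifP => [/andP[_ /eqP Es2] _ | _ /eqP Ev].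
      have [_ ->] := slot_inj lt_q1 lt_q Es1.
      by have [_ ->] := slot_inj lt_q2 lt_q Es2.
    by case/negP: (v_other q2 lt_q2 Ex).
  case: ifP => [/andP[/eqP Ex _] /esym/eqP Ev | _]; last exact: iu.
  by case/negP: (v_other q1 lt_q1 Ex).
Qed.

(** * Counting the filled memory cells *)

Variable L : {set 'I_n}.

Definition counted x : bool := match x with inl u => u \in L | inr _ => true end.

(** This is the potential of the amortized count. Restricting it to records of [L] and [W] gives a
    bound in terms of [|L| + |W|]. *)
Definition filled_cells M : nat :=
  \sum_(p : vtx * 'I_B | counted p.1) (cell M p.1 p.2 != 0).

Lemma filled_cells_le M : filled_cells M <= (#|L| + m) * B.
Proof.
apply: leq_trans (_ : \sum_(p : vtx * 'I_B | counted p.1) 1 <= _).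
  by apply: leq_sum => p _; case: (_ != 0).
rewrite (eq_bigl (fun p => counted p.1 && xpredT p.2)) => [|p]; last first.
  by rewrite andbT.
rewrite -(pair_big counted xpredT (fun _ _ => 1)) /=.
under eq_bigr do rewrite sum1_card card_ord.
rewrite big_sumType /= !sum_nat_const mulnDl; apply: leq_add => //.
by rewrite cardT size_enum_ord.
Qed.

Lemma filled_cells_write M x o v : counted x -> o < B -> cell M x o = 0 -> v != 0 ->
  filled_cells (write M x o v) = (filled_cells M).+1.
Proof.
move=> cx lt_o E0 nz; rewrite /filled_cells.
rewrite (bigD1 (x, Ordinal lt_o)) //= cell_write // !eqxx /= nz add1n.
rewrite [in RHS](bigD1 (x, Ordinal lt_o)) //= E0 eqxx add0n; congr _.+1.
apply: eq_bigr => -[y o'] /= /andP[_ ne]; rewrite cell_write //.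
case: ifP => // /andP[/eqP Ey /eqP Eo]; case/eqP: ne.
by congr pair => //; apply: val_inj.
Qed.

End Invariant.

(** * Processing one edge *)

Section Steps.
Variables (k n m h b : nat) (T : rel 'I_n) (r : 'I_n) (F : {set 'I_n * 'I_m}).
Variable L : {set 'I_n}.
Local Notation B := (record_size k).
Local Notation edge := ('I_n * 'I_m)%type.
Local Notation vtx := (vertex n m).
Local Notation anc := (anc T r).
Local Notation cell := (@cell k n m).
Local Notation loop_invariant := (@loop_invariant k n m T r).
Local Notation U := (union_graph T F).
Local Arguments eval : simpl never.

Hypothesis word_large : B * (n + m).+1 <= 2 ^ b.
Hypothesis k_gt1 : 1 < k.
Hypotheses (symT : symmetric T) (connT : forall x y, connect T x y).
Hypothesis F_bottom : forall e, e \in F -> depth T r e.1 = h.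
Hypothesis F_leaf : forall e, e \in F -> e.1 \in L.

Definition reg_file s (p : seq vtx) : Prop :=
  forall i x, i < size p -> regs s i.+1 = ident (nth x p i).

Lemma large_word : 4 * k < 2 ^ b.
Proof.
apply: leq_trans word_large; rewrite /record_size /slots /table_size.
by nia.
Qed.

Lemma word_gt1 : 1 < 2 ^ b.
Proof. by apply: leq_ltn_trans large_word; lia. Qed.

Lemma run_insert j full c q s (e : edge) :
    regs s 1 = ident (inr e.2 : vtx) -> regs s 4 = ident (inl e.1 : vtx) ->
    j < k -> q + c <= slots k ->
  (exists q1, [/\ q <= q1 < q + c,
     forall q', q <= q' < q1 -> cell (Defs.mem s) (endp k q' e) (slot k j q') != 0,
     cell (Defs.mem s) (endp k q1 e) (slot k j q1) = 0
   & run b (insert k j full c q) s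
     = State (regs s) (write k (Defs.mem s) (endp k q1 e) (slot k j q1)
                         (ident (far k q1 e))) (input s) (output s)])
  \/ (forall q', q <= q' < q + c ->
        cell (Defs.mem s) (endp k q' e) (slot k j q') != 0)
     /\ run b (insert k j full c q) s = run b full s.
Proof.
move=> R1 R4 lt_j; elim: c q => [|c IH] q le_q.
  by right; split=> // q'; lia.
have lt_o : slot k j q < B by apply: slot_lt => //; lia.
have Eh : eval b s (Reg (here k q)) = ident (endp k q e).
  by rewrite /here /endp /eval; case: (at_u k q).
have Et : eval b s (Reg (there k q)) = ident (far k q e).
  by rewrite /there /far /eval; case: (at_u k q).
rewrite /= (eval_cell word_large Eh lt_o); case: eqP => [E0 | /eqP nz] /=.
  left; exists q; split=> //; first lia.
    by move=> q'; lia.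
  by rewrite (eval_addr word_large Eh lt_o) Et.
have [|[q1 [le_q1 prev E1 ->]]|[prev ->]] := IH q.+1; first lia.
  left; exists q1; split=> //; first lia.
  move=> q' le_q'; case: (eqVneq q q') => [<- //|ne]; apply: prev; lia.
right; split=> // q' le_q'.
case: (eqVneq q q') => [<- //|ne]; apply: prev; lia.
Qed.

Lemma eval_used t s ex v : eval b s ex = v -> 4 + t < 2 ^ b ->
  eval b s (usedE t ex) = count (fun i => regs s i == v) (iota 1 (4 + t)).
Proof.
move=> Ev; rewrite /usedE -{1}(size_iota 1 (4 + t)).
elim: (iota 1 (4 + t)) => [|i l IH] lt_l; first exact: mod0n.
have {}IH := IH (ltn_trans (ltnSn _) lt_l).
rewrite /= /eval /= -!/(eval b s _) IH -/(eval b s _) Ev.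
(* The partial sums are at most the number of registers, hence do not wrap around. *)
have := count_size (fun i => regs s i == v) l; move: lt_l => /= lt_l le_c.
by rewrite (@word_small b (_ == _)) ?word_small //; case: (_ == v) => /=; lia.
Qed.

(** Pigeonhole: the full table has [2k] distinct entries, and fewer than [2k] vertices are in
    use. *)
Lemma run_pick_next d j t s p x0 q0 :
    loop_invariant d (Defs.mem s) -> j < k -> q0 + table_size k <= slots k ->
    size p = 4 + t -> size p < table_size k -> reg_file s p ->
    (forall q, q0 <= q < q0 + table_size k ->
       cell (Defs.mem s) (last x0 p) (slot k j q) != 0) ->
  exists q (y : vtx), [/\ q0 <= q < q0 + table_size k,
    cell (Defs.mem s) (last x0 p) (slot k j q) = ident y, y \notin p
    & run b (pick_next k j t (table_size k) q0) s
      = State (upd (regs s) (5 + t) (ident y)) (Defs.mem s) (input s) (output s)].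
Proof.
move=> inv lt_j le_q0 sp lt_p Rp filled; set x := last x0 p.
have Rx : eval b s (Reg (4 + t)) = ident x.
  rewrite /eval (Rp (3 + t) x0) ?sp // /x -nth_last sp; congr ident.
have slotP q : q0 <= q < q0 + table_size k ->
    exists y : vtx, cell (Defs.mem s) x (slot k j q) = ident y.
  move=> q_in; have [|||e [f [_ E _ _ _]]] := inv_slot inv (x := x) (j := j) (q := q).
  - by [].
  - by lia.
  - exact: filled.
  by exists (far k q e).
have usedP q : q0 <= q < q0 + table_size k ->
    (eval b s (usedE t (cellE k (Reg (4 + t)) (slot k j q))) != 0)
      = (cell (Defs.mem s) x (slot k j q) \in [seq ident y | y <- p]).
  move=> q_in; have lt_o : slot k j q < B by apply: slot_lt => //; lia.
  rewrite (eval_used (eval_cell word_large Rx lt_o)); last first.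
    by have := large_word; move: lt_p; rewrite sp /table_size; lia.
  rewrite -lt0n -has_count; apply/hasP/mapP => [[i]|[y y_p ->]].
    rewrite mem_iota => lt_i /eqP <-; exists (nth x0 p i.-1).
      by rewrite mem_nth // sp; lia.
    by rewrite -(Rp i.-1 x0) ?sp ?prednK //; lia.
  exists (index y p).+1; first by rewrite mem_iota -sp ltnS /= add1n ltnS index_mem.
  by rewrite (Rp _ x0) ?index_mem ?nth_index.
(* The last [c] slots of the table are still to be tried; [c = 0] contradicts the pigeonhole
   principle. *)
have search c q : q0 <= q -> q + c = q0 + table_size k ->
    (forall q', q0 <= q' < q ->
       cell (Defs.mem s) x (slot k j q') \in [seq ident y | y <- p]) ->
  exists q' (y : vtx), [/\ q0 <= q' < q0 + table_size k,
    cell (Defs.mem s) x (slot k j q') = ident y, y \notin p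
    & run b (pick_next k j t c q) s
      = State (upd (regs s) (5 + t) (ident y)) (Defs.mem s) (input s) (output s)].
  elim: c q => [|c IH] q le_q Eq used.
    pose ys := [seq cell (Defs.mem s) x (slot k j q') | q' <- iota q0 (table_size k)].
    have u_ys : uniq ys.
      rewrite map_inj_in_uniq ?iota_uniq // => q1 q2; rewrite !mem_iota => in1 in2.
      by apply: (inv_uniq inv) => //; [lia | lia | exact: filled].
    have sub : {subset ys <= [seq ident y | y <- p]}.
      move=> _ /mapP[q' + ->]; rewrite mem_iota => q'_in.
      by apply: used; rewrite -Eq addn0 in q'_in.
    have := uniq_leq_size u_ys sub; rewrite !size_map size_iota => le.
    by have := leq_trans lt_p le; rewrite ltnn.
  have q_in : q0 <= q < q0 + table_size k by lia.
  rewrite /= usedP //; case: ifP => in_p.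
    apply: IH; [lia | lia |] => q' q'_in.
    by case: (eqVneq q' q) => [-> //|ne]; apply: used; lia.
  have [y Ey] := slotP q q_in; exists q, y; split=> //.
    by apply: contraFN in_p => y_p; rewrite Ey map_f.
  by rewrite (eval_cell word_large Rx) ?slot_lt ?Ey //; lia.
by apply: search => // q'; lia.
Qed.

(** A vertex of [W] goes with its first neighbour. Both ends of a stored edge of level [j] then
    belong to the same [a], so the leaves on a walk all lie below [a]. *)
Definition belongs M j (a : 'I_n) (x : vtx) : Prop :=
  match x with
  | inl u => anc j u = a
  | inr w => exists2 f, cell M (inr w) 1 = ident (inl f : vtx) & anc j f = a
  end.

Lemma at_u_table i c : c < table_size k -> at_u k (i * table_size k + c) = odd i.
Proof.
by move=> lt_c; rewrite /at_u divnMDl ?(divn_small lt_c) ?addn0 //; lia.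
Qed.

Lemma endp_edge (e : edge) q : e \in F -> U (endp k q e) (far k q e).
Proof. by rewrite /endp /far; case: (at_u k q); case: e. Qed.

(* The table with index [s.-1] is the one read at [last x0 p]; [e] is the edge
   through which the walk arrived there. *)
Lemma run_walk d j a s t st p x0 (e : edge) :
    loop_invariant d (Defs.mem st) -> {subset d <= F} -> j < k ->
    s <= table_size k -> 4 + t + s <= table_size k ->
    size p = 4 + t -> uniq p -> reg_file st p ->
    last x0 p = (if odd s then inr e.2 else inl e.1) ->
    belongs (Defs.mem st) j a (last x0 p) ->
    (forall q, q < s * table_size k ->
       cell (Defs.mem st) (endp k q e) (slot k j q) != 0) ->
  exists R p' z, [/\ size p' = s /\ uniq (p ++ p'), path U (last x0 p) p',
    all (at_bottom h T r) p', last (last x0 p) p' = inl z /\ anc j z = a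
    & run b (walk k j s t) st = State R (Defs.mem st) (input st) (output st)
      /\ (R 0 = regs st 0 /\
          reg_file (State R (Defs.mem st) (input st) (output st)) (p ++ p'))].
Proof.
elim: s t st p e => [|s IH] t st p e inv dF lt_j le_s le_t sp up Rp lp bel filled.
  exists (regs st), [::], e.1; rewrite cats0; split=> //.
  - by move: bel; rewrite lp.
  - by case: (st) Rp.
have le_slots : s * table_size k + table_size k <= slots k.
  by rewrite -mulSnr leq_mul2r le_s orbT.
have Ex q : s * table_size k <= q < s * table_size k + table_size k ->
    at_u k q = odd s.
  by move=> q_in; rewrite -(@subnKC (s * table_size k) q) ?at_u_table //; lia.
have [||q [y [q_in Ey y_p Erun]]] :=
  run_pick_next inv lt_j le_slots sp _ Rp (x0 := x0) (q0 := s * table_size k).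
- by rewrite sp; lia.
- move=> q q_in; have := filled q; rewrite /endp (Ex q q_in) lp.
  by rewrite if_neg; apply; rewrite mulSnr; lia.
have lt_q : q < slots k by lia.
have nz : cell (Defs.mem st) (last x0 p) (slot k j q) != 0 by rewrite Ey.
(* All slots before [q] are filled at the ends of [e'], so [e'] takes the role of [e] for the next
   table. *)
have [e' [f' [Ex' Ey' ed' [E1 ae] prev]]] := inv_slot inv lt_j lt_q nz.
have {Ey Ey'} Ey : y = far k q e' by apply: ident_inj; rewrite -Ey.
have e'F := dF _ ed'.
set st' := State _ _ _ _ in Erun.
have Rp' : reg_file st' (rcons p y).
  move=> i x; rewrite size_rcons ltnS nth_rcons /= /upd => le_i.
  rewrite -[5 + t]/(4 + t).+1 -sp eqSS; case: ltngtP le_i => // lt_i _.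
  exact: Rp.
have [|||||||R [p' [z [[sp' up'] path_p' bot_p' last_p' [Erun' [R0 Rp'']]]]]] :=
  IH t.+1 st' (rcons p y) e' inv dF lt_j _ _ _ _ Rp' _ _ _.
- by lia.
- by lia.
- by rewrite size_rcons sp addnS.
- by rewrite rcons_uniq y_p.
- by rewrite last_rcons Ey /far Ex.
- rewrite last_rcons Ey /far; move: bel; rewrite Ex' /endp /=.
  case: (at_u k q) => /=; first by move=> <-; exists f'.
  by case=> f; rewrite E1 => /ident_inj[<-] <-.
- by move=> q' lt_q'; apply: prev; lia.
rewrite last_rcons in path_p' last_p'; rewrite !cat_rcons in up' Rp''.
exists R, (y :: p'), z; split=> //.
- by rewrite /= sp'.
- by rewrite /= path_p' Ex' Ey endp_edge.
- rewrite /= bot_p' andbT Ey /far; case: (at_u k q) => //=.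
  by rewrite F_bottom.
by rewrite /= Erun Erun' R0.
Qed.

Definition good_item (it : item n m) : Prop :=
  [/\ it.1 \in F, size it.2 = 2 * k, cycle U it.2, uniq it.2
    & edge_of it.1 \in cycle_edges it.2].

Lemma eval_eq s e1 e2 x y : eval b s e1 = ident (x : vtx) ->
  eval b s e2 = ident (y : vtx) -> eval b s (Bin Eq e1 e2) = (x == y).
Proof.
have lt_b := word_gt1.
rewrite /eval -/(eval b s e1) -/(eval b s e2) => -> -> /=.
by rewrite word_small ?(inj_eq (@ident_inj n m)) //; case: (_ == _) => //; apply: ltnW.
Qed.

Lemma run_report d j u w f g p z st :
    loop_invariant d (Defs.mem st) -> 0 < j < k -> (u, w) \in F ->
    (f, w) \in F -> (g, w) \in F ->
    anc j g = anc j f -> anc j.-1 g != anc j.-1 f -> anc j z = anc j f ->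
    size p = tables k j -> uniq [:: inr w, inl f, inl g, inl u & p] ->
    path U (inl u) p -> all (at_bottom h T r) p -> last (inl u) p = inl z ->
    reg_file st [:: inr w, inl f, inl g, inl u & p] ->
  exists R c, [/\ good_item ((u, w), c), R 0 = regs st 0
    & run b (report k j) st
      = State R (Defs.mem st) (input st) 
          (output st ++ encode_item ((u, w), c : seq vtx))].
Proof.
move=> inv /andP[j0 lt_j] uwF fwF gwF ag neq az sp up pp bp lp Rp.
pose x0 : vtx := inl u.
have b_gt1 := word_gt1.
(* The choice made by [report], which changes register 2 only. *)
pose a' := if anc j.-1 z == anc j.-1 f then g else f.
pose R := if anc j.-1 z == anc j.-1 f then upd (regs st) 2 (regs st 3) else regs st.
exists R, (close T r a' w (inl u :: p) z j).
have awF : (a', w) \in F by rewrite /a'; case: ifP.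
have aa : anc j z = anc j a' by rewrite /a'; case: ifP; rewrite az ?ag.
have na : anc j.-1 z != anc j.-1 a'.
  rewrite /a'; case: ifP => [/eqP->|->] //; by rewrite eq_sym.
have ua : uniq [:: inl a', inr w, inl u & p].
  move: up; rewrite /a' /= !inE !negb_or /=; case: ifP => _.
    by case/and5P=> -> _ -> -> ->.
  by case/and5P=> -> /andP[_ ->] _ -> ->.
have ba : all (at_bottom h T r) [:: inl a', inl u & p].
  by rewrite /= bp (F_bottom awF) (F_bottom uwF) !eqxx.
have Rk i : i != 2 -> R i = regs st i.
  by rewrite /R /upd; case: ifP => // _ /negbTE->.
split; last 1 first.
- pose st1 := State R (Defs.mem st) (input st) (output st).
  have R2 : eval b st1 (Reg 2) = ident (inl a' : vtx).
    rewrite /eval /= /R /a'; case: ifP => _; last exact: (Rp 1 x0).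
    by rewrite /upd /= (Rp 2 x0).
  have nthz : nth x0 (inl u :: p) (tables k j) = inl z.
    by rewrite -sp -lp (last_nth x0).
  have Rpath t s1 : s1 = st1 \/ s1 = st -> t <= tables k j ->
      eval b s1 (Reg (4 + t)) = ident (nth x0 (inl u :: p) t).
    move=> Es le_t; have -> : eval b s1 (Reg (4 + t)) = regs st (3 + t).+1.
      by rewrite /eval; case: Es => -> //=; rewrite Rk.
    by rewrite (Rp _ x0) //= sp !ltnS.
  have par := inv_parent inv.
  have B0 : 0 < B by [].
  have Ez s1 : s1 = st1 \/ s1 = st ->
      eval b s1 (Reg (4 + tables k j)) = ident (inl z : vtx).
    by move=> Es; rewrite Rpath // nthz.
  have Etest : eval b st (Bin Eq (ancE k j.-1 (Reg (4 + tables k j)))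
        (ancE k j.-1 (Reg 2))) = (anc j.-1 z == anc j.-1 f).
    have E1 := eval_anc word_large j.-1 B0 par (Ez st (or_intror erefl)).
    have E2 := eval_anc word_large j.-1 B0 par (Rp 1 x0 erefl : eval b st (Reg 2) = _).
    by rewrite (eval_eq E1 E2).
  have Eif : run b (If (Bin Eq (ancE k j.-1 (Reg (4 + tables k j)))
      (ancE k j.-1 (Reg 2))) (Assign 2 (Reg 3)) Skip) st = st1.
    rewrite /= Etest /st1 /R; case: (anc j.-1 z == _) => //=.
    by case: (st).
  have -> : run b (report k j) st
      = run b (outputs ([:: Reg 4; Reg 1] ++ cycleE k j)) st1 by rewrite -Eif.
  rewrite (run_outputs word_large
    (xs := [:: inl u; inr w] ++ close T r a' w (inl u :: p) z j) b_gt1) //.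
  rewrite /cycleE /close !map_cat -!map_comp.
  have R4 := Rpath 0 st1 (or_introl erefl) isT.
  have R1 : eval b st1 (Reg 1) = ident (inr w : vtx).
    by rewrite /eval /= Rk // (Rp 0 x0).
  congr (_ ++ (_ ++ (_ ++ (_ ++ _)))).
  + by rewrite /= R1 (R4 : eval b st1 (Reg 4) = _).
  + by rewrite /= R1 R2.
  + rewrite -[in RHS](mkseq_nth x0 (inl u :: p)) /mkseq -map_comp.
    have -> : size (inl u :: p) = (tables k j).+1 by rewrite -sp.
    apply/eq_in_map => t; rewrite mem_iota add0n ltnS => /andP[_ le_t].
    by apply: Rpath => //; left.
  + apply: eq_map => i /=; apply: (eval_anc word_large) => //.
    by apply: Ez; left.
  + by apply: eq_map => i /=; apply: (eval_anc word_large).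
- split=> //.
  + rewrite [LHS]size_close [size _]/= sp /tables.
    by clear -j0 lt_j; lia.
  + exact: (cycle_close symT connT j0 uwF awF pp lp ua ba aa na).
  + exact: (uniq_close connT j0 uwF awF pp lp ua ba na).
  + exact: edge_close.
- by rewrite Rk.
Qed.

(** The dichotomy behind the count: an edge is paid for by a new filled cell or by a new cycle. *)
Definition progress d e s s1 : Prop :=
  [/\ output s1 = output s, loop_invariant (e :: d) (Defs.mem s1)
    & filled_cells k m L (Defs.mem s1) = (filled_cells k m L (Defs.mem s)).+1]
  \/ Defs.mem s1 = Defs.mem s /\ exists c, good_item (e, c)
       /\ output s1 = output s ++ encode_item (e, c).

Definition outcome d e s s1 : Prop :=
  [/\ regs s1 0 = regs s 0, input s1 = input s & progress d e s s1].

Lemma run_dispatch d e f s j :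
    loop_invariant d (Defs.mem s) -> {subset d <= F} -> e \in F -> e \notin d ->
    regs s 1 = ident (inr e.2 : vtx) -> regs s 2 = ident (inl f : vtx) ->
    regs s 4 = ident (inl e.1 : vtx) ->
    cell (Defs.mem s) (inr e.2) 1 = ident (inl f : vtx) -> (f, e.2) \in d ->
    j < k -> anc j e.1 = anc j f ->
  outcome d e s (run b (dispatch k j) s).
Proof.
move=> inv dF eF e_d R1 R2 R4 E1 fd; elim: j => [|j IH] lt_j.
  (* At level 0 the ancestors are the leaves themselves, so [e] would already be in [d]. *)
  by move=> /= Ef; rewrite (surjective_pairing e) (Ef : e.1 = f) fd in e_d.
move=> aj; have lt_o := ref_lt lt_j.
have par := inv_parent inv; have B0 : 0 < B by [].
have neq_u g : (g, e.2) \in d -> (inl g : vtx) != inl e.1.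
  by move=> gd; apply: contraNneq e_d => -[Eg]; rewrite (surjective_pairing e) -Eg.
have R1e : eval b s (Reg 1) = ident (inr e.2 : vtx) by [].
have R2e : eval b s (Reg 2) = ident (inl f : vtx) by [].
have R4e : eval b s (Reg 4) = ident (inl e.1 : vtx) by [].
rewrite [run _ _ _]/= (eval_cell word_large R1e lt_o); case: eqP => [E0 | /eqP nz] /=.
  have A4 := eval_anc word_large j B0 par R4e.
  have A2 := eval_anc word_large j B0 par R2e.
  rewrite (eval_eq A4 A2) eqb0 negbK; case: eqVneq => [[Ea]|ne] /=.
    by apply: IH; first exact: ltnW.
  rewrite (eval_addr word_large R1e lt_o) R4e; split=> //; left; split=> //.
  - rewrite {1}(surjective_pairing e).
    apply: (inv_write_ref inv lt_j E0 (or_intror (conj E1 fd))).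
    by rewrite /lca_level aj eqxx.
  - exact: filled_cells_write.
have [f' [g [E1' Eg _ gd /andP[/eqP ag /= neq]]]] := inv_ref inv lt_j nz.
have Ef : f' = f by move: E1'; rewrite E1 => /ident_inj[].
rewrite {f' E1'}Ef in ag neq.
set s2 := State _ _ _ _.
have lt_tab : tables k j.+1 <= table_size k by rewrite /tables /table_size; lia.
have := @run_insert j.+1 (Seq (walk k j.+1 (tables k j.+1) 0) (report k j.+1))
  (tables k j.+1 * table_size k) 0 s2 e R1 R4 lt_j.
rewrite add0n leq_mul2r lt_tab orbT => /(_ isT).
case=> [[q [/andP[_ lt_q] prev E0 ->]] | [full ->]].
  have lt_qs : q < slots k by apply: table_slots lt_q.
  split=> //; left; split=> //.
    by apply: (inv_write_slot inv lt_j lt_qs e_d E0 E1 aj).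
  apply: filled_cells_write => //.
    by rewrite /endp; case: (at_u k q) => //=; apply: F_leaf.
  exact: slot_lt.
(* All slots are full, and the walk starts from these four registers; [f] and [g] differ because
   their ancestors at level [j] do. *)
pose p0 : seq vtx := [:: inr e.2; inl f; inl g; inl e.1].
have up0 : uniq p0.
  rewrite /= !inE /= !negb_or !neq_u //= !andbT.
  by apply: contraNneq neq => -[->].
have Rp0 : reg_file s2 p0.
  by move=> [|[|[|[|i]]]] x //= _; rewrite /upd //= (eval_cell word_large R1e lt_o).
have [|||||||R [p' [z [[sp' up'] path_p' bot_p' [last_p' az] [Erun [R0 Rp']]]]]] :=
  @run_walk d j.+1 (anc j.+1 f) (tables k j.+1) 0 s2 p0 (inl e.1) e inv dF lt_j
     lt_tab _ _ _ _ _ _ _.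
- by rewrite /tables /table_size; lia.
- by [].
- exact: up0.
- exact: Rp0.
- by rewrite /= /tables odd_double.
- exact: aj.
- by move=> q lt_q; apply: full.
have j_in : 0 < j.+1 < k by [].
have eF' : (e.1, e.2) \in F by rewrite -surjective_pairing.
have [R' [c [good_c R0' Erep]]] :=
  run_report (st := State R (Defs.mem s2) (input s2) (output s2)) inv j_in eF'
    (dF _ fd) (dF _ gd) ag neq az sp' up' path_p' bot_p' last_p' Rp'.
rewrite -surjective_pairing in good_c Erep; rewrite -[run _ _ _]/(run b (report k j.+1)
  (run b (walk k j.+1 (tables k j.+1) 0) s2)) Erun Erep; split=> //=.
  by rewrite R0' /= R0.
by right; split=> //; exists c.
Qed.

Lemma ident_lt (x : vtx) : ident x < 2 ^ b.
Proof.
have B0 : 0 < B by [].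
by have := addr_lt word_large x B0; apply: leq_ltn_trans; rewrite addn0 leq_pmull.
Qed.

Lemma run_read_id i (x : vtx) s rest : input s = label x :: rest ->
  run b (read_id i) s
    = State (upd (upd (regs s) i (label x)) i (ident x)) (Defs.mem s) rest (output s).
Proof.
move=> E; have lt_x := ident_lt x; have lt_1 := word_gt1.
rewrite /= E /= word_small; last exact: ltnW.
congr State; congr upd; rewrite /eval /= /upd eqxx (word_small lt_1) addn1.
exact: word_small.
Qed.

Hypothesis lt_hk : h < k.

Lemma run_edge_step d e s rest :
    loop_invariant d (Defs.mem s) -> {subset d <= F} -> e \in F -> e \notin d ->
    regs s 0 < 2 ^ b ->
    input s = [:: label (inl e.1 : vtx), label (inr e.2 : vtx) & rest] ->
  [/\ regs (run b (edge_step k) s) 0 = (regs s 0).-1,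
    input (run b (edge_step k) s) = rest
    & progress d e s (run b (edge_step k) s)].
Proof.
move=> inv dF eF e_d R0 Es.
move Es1 : (run b (read_id 1) (run b (read_id 4) s)) => s1.
have [R1_0 R1_1 R1_4 M1 [I1 O1]] : [/\ regs s1 0 = regs s 0,
    regs s1 1 = ident (inr e.2 : vtx), regs s1 4 = ident (inl e.1 : vtx),
    Defs.mem s1 = Defs.mem s & input s1 = rest /\ output s1 = output s].
  rewrite -Es1 (@run_read_id 4 (inl e.1) _ _ Es).
  by rewrite (@run_read_id 1 (inr e.2) _ rest).
pose c := If (cellE k (Reg 1) 1)
  (Seq (Assign 2 (cellE k (Reg 1) 1)) (dispatch k k.-1))
  (Store (addrE k (Reg 1) 1) (Reg 4)).
suff [R2 I2 P2] : outcome d e s1 (run b c s1).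
  have -> : run b (edge_step k) s
      = run b (Assign 0 (Bin Defs.Sub (Reg 0) (Cst 1))) (run b c s1).
    by rewrite -Es1.
  split=> /=.
  - rewrite /upd /eval /= R2 R1_0 (word_small word_gt1) subn1 word_small //.
    exact: leq_ltn_trans (leq_pred _) R0.
  - by rewrite I2 I1.
  - by move: P2; rewrite /progress /= M1 O1.
have lt_1 : 1 < B by rewrite /record_size; lia.
have k_gt0 : 0 < k by lia.
have R1e : eval b s1 (Reg 1) = ident (inr e.2 : vtx) by [].
rewrite -M1 in inv; rewrite /= (eval_cell word_large R1e lt_1).
case: eqP => [E0 | /eqP nz] /=.
  rewrite (eval_addr word_large R1e lt_1) [eval _ _ _]R1_4.
  split=> //; left; split=> //.
    rewrite {1}(surjective_pairing e).
    apply: (inv_write_ref (f := e.1) inv k_gt0 E0); first by left.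
    by rewrite /lca_level eqxx.
  exact: filled_cells_write.
have [f [g [E1 _ fd _ _]]] := inv_ref inv k_gt0 nz.
set s2 := State _ _ _ _.
suff: outcome d e s2 (run b (dispatch k k.-1) s2) by [].
apply: (run_dispatch (f := f)) => //; first by rewrite prednK.
(* At the starting level [k.-1] both ancestors are the root. *)
have le_h : h <= k.-1 by lia.
rewrite (anc_root connT (F_bottom eF) le_h).
by rewrite (anc_root connT (F_bottom (dF _ fd)) le_h).
Qed.

End Steps.

(** * The two loops *)

Section Program.
Variables (k n m h b : nat) (T : rel 'I_n) (r : 'I_n) (F : {set 'I_n * 'I_m}).
Variable fs : seq ('I_n * 'I_m).
Local Notation B := (record_size k).
Local Notation edge := ('I_n * 'I_m)%type.
Local Notation vtx := (vertex n m).
Local Notation L := (leaves T r).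
Local Arguments eval : simpl never.

Hypothesis word_large : B * (n + m).+1 <= 2 ^ b.
Hypothesis size_word : size fs < 2 ^ b.
Hypotheses (lt_hk : h < k) (k_gt1 : 1 < k).
Hypotheses (symT : symmetric T) (connT : forall x y, connect T x y).
Hypothesis leaf_depth : forall v, v \in L -> depth T r v = h.
Hypothesis F_sub : F \subset setX L [set: 'I_m].
Hypothesis fs_F : perm_eq fs (enum F).

Definition parent_list : seq nat :=
  [seq label (inl (parent T r v) : vtx) | v <- enum 'I_n].
Definition edge_list (l : seq edge) : seq nat :=
  flatten [seq [:: label (inl f.1 : vtx); label (inr f.2 : vtx)] | f <- l].

Definition parents_read i s : Prop :=
  [/\ regs s 0 = size fs /\ regs s 1 = n, regs s 2 = i,
    input s = drop i parent_list ++ edge_list fs /\ output s = [::],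
    forall u : 'I_n, u < i ->
      cell k (Defs.mem s) (inl u : vtx) 0 = ident (inl (parent T r u) : vtx)
    & forall (x : vtx) o, 0 < o < B -> cell k (Defs.mem s) x o = 0].

(** The edges of the items are kept distinct, so the reported pairs differ even if a cycle is found
    for several edges. *)
Definition edges_read i s : Prop :=
  exists items : seq (item n m),
  [/\ loop_invariant (m := m) k T r (rev (take i fs)) (Defs.mem s),
    regs s 0 = size fs - i /\ input s = edge_list (drop i fs),
    output s = flatten (map (@encode_item n m) items)
      /\ i <= filled_cells k m L (Defs.mem s) + size items,
    forall it, it \in items -> good_item k T F it
    & uniq (map fst items) /\ {subset map fst items <= take i fs}].

Let F_bottom e : e \in F -> depth T r e.1 = h.
Proof. by move/(subsetP F_sub); rewrite inE => /andP[/leaf_depth]. Qed.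

Let F_leaf e : e \in F -> e.1 \in L.
Proof. by move/(subsetP F_sub); rewrite inE => /andP[]. Qed.

Let mem_fs : fs =i F.
Proof. by move=> e; rewrite (perm_mem fs_F) mem_enum. Qed.

Let uniq_fs : uniq fs.
Proof. by rewrite (perm_uniq fs_F) enum_uniq. Qed.

Let n_gt0 : 0 < n.
Proof. exact: leq_ltn_trans (ltn_ord r). Qed.

Lemma size_parent_list : size parent_list = n.
Proof. by rewrite size_map size_enum_ord. Qed.

Lemma parents_read_step i s : i < n -> parents_read i s ->
  eval b s (Bin Lt (Reg 2) (Reg 1)) != 0
    /\ parents_read i.+1 (run b (parent_step k) s).
Proof.
move=> lt_in [[R0 R1] R2 [Is Os] par zero].
have lt_1 := word_gt1 word_large k_gt1.
split; first by rewrite /eval /= R2 R1 lt_in (word_small lt_1).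
pose v := Ordinal lt_in; pose x : vtx := inl (parent T r v).
have Ein : input s = label x :: (drop i.+1 parent_list ++ edge_list fs).
  rewrite Is (drop_nth 0) ?size_parent_list // cat_cons; congr (_ :: _).
  rewrite (nth_map v) ?size_enum_ord // (_ : nth _ _ _ = v) //.
  by apply: val_inj; rewrite /= nth_enum_ord.
move Es1 : (run b (read_id 3) s) => s1.
have [[R1_0 R1_1] R1_2 R1_3 M1 [I1 O1]] : [/\ regs s1 0 = size fs /\ regs s1 1 = n,
    regs s1 2 = i, regs s1 3 = ident x, Defs.mem s1 = Defs.mem s
    & input s1 = drop i.+1 parent_list ++ edge_list fs /\ output s1 = [::]].
  by rewrite -Es1 (run_read_id word_large k_gt1 3 Ein).
have -> : run b (parent_step k) s = run b (Seq (Assign 2 (Bin Add (Reg 2) (Cst 1)))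
    (Store (addrE k (Reg 2) 0) (Reg 3))) s1 by rewrite -Es1.
have B0 : 0 < B by [].
have E2 : eval b s1 (Bin Add (Reg 2) (Cst 1)) = ident (inl v : vtx).
  rewrite /eval /= R1_2 (word_small lt_1) addn1 word_small //.
  exact: (ident_lt word_large (inl v : vtx)).
rewrite /= E2; set s2 := State _ (Defs.mem s1) _ _.
have E2' : eval b s2 (Reg 2) = ident (inl v : vtx) by [].
rewrite (eval_addr word_large E2' B0) M1.
split=> //=.
- move=> u; rewrite ltnS => le_u; rewrite cell_upd // andbT.
  case: eqP => [[->] //|ne]; apply: par; rewrite ltn_neqAle le_u andbT.
  by apply/eqP => Eu; apply: ne; congr inl; apply: val_inj.
- move=> y o /andP[o_gt0 lt_o]; rewrite cell_upd //; case: ifP => [/andP[_ /eqP o0]|_].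
    by rewrite o0 in o_gt0.
  by apply: zero; rewrite o_gt0.
Qed.

(** Only the parents are stored so far, so the clauses on neighbours and slots hold vacuously. *)
Lemma edges_read_start s : parents_read n s -> edges_read 0 s.
Proof.
case=> [[R0 _] _ [Is Os] par zero]; exists [::].
have ref_in j : j < k -> 0 < j.+1 < B by move=> lt_j; rewrite ref_lt.
have slot_in j q : j < k -> q < slots k -> 0 < slot k j q < B.
  by move=> lt_j lt_q; rewrite slot_lt // andbT (leq_trans _ (slot_gt k j q)).
rewrite take0 drop0 subn0 /=; split=> //.
- split=> [u|w j lt_j|x j q lt_j lt_q|x j q q' lt_j lt_q].
  + exact: par.
  + by rewrite zero ?ref_in.
  + by rewrite zero ?slot_in.
  + by rewrite [cell _ _ x (slot k j q)]zero ?slot_in.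
- by rewrite Is drop_oversize // size_parent_list.
Qed.

Lemma edges_read_step i s : i < size fs -> edges_read i s ->
  eval b s (Reg 0) != 0 /\ edges_read i.+1 (run b (edge_step k) s).
Proof.
move=> lt_i [items [inv [R0 Is] [Os cnt] good [u_items sub]]].
split; first by rewrite /eval R0 subn_eq0 -ltnNge.
have e0 : edge by case: (fs) lt_i.
set e := nth e0 fs i; have e_fs : e \in fs by rewrite mem_nth.
have e_take : e \notin take i fs.
  have: uniq (take i.+1 fs) by rewrite take_uniq.
  by rewrite (take_nth e0) // rcons_uniq => /andP[].
have dF : {subset rev (take i fs) <= F}.
  by move=> x; rewrite mem_rev => /mem_take; rewrite mem_fs.
have eF : e \in F by rewrite -mem_fs.
have e_d : e \notin rev (take i fs) by rewrite mem_rev.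
have lt_R0 : regs s 0 < 2 ^ b 
  by rewrite R0; apply: leq_ltn_trans size_word; rewrite leq_subr.
have Is' : input s
    = [:: label (inl e.1 : vtx), label (inr e.2 : vtx) & edge_list (drop i.+1 fs)].
  by rewrite Is (drop_nth e0).
have [R' I' P] := run_edge_step word_large k_gt1 symT connT F_bottom F_leaf lt_hk
  inv dF eF e_d lt_R0 Is'.
have take_S : rev (take i.+1 fs) = e :: rev (take i fs).
  by rewrite (take_nth e0) // rev_rcons.
have subS : {subset take i fs <= take i.+1 fs}.
  by move=> x x_in; rewrite (take_nth e0) // mem_rcons inE x_in orbT.
rewrite R0 -subnS in R'.
case: P => [[O' inv' cnt'] | [M' [c [good_c O']]]].
  exists items; rewrite take_S; split=> //.
  - by rewrite O' cnt'; split=> //; rewrite addSn ltnS.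
  - by split=> // x /sub/subS.
exists (rcons items (e, c)); rewrite take_S; split=> //.
- by rewrite M'; apply: inv_mono.
- by rewrite O' M' Os map_rcons flatten_rcons size_rcons addnS ltnS.
- by move=> it; rewrite mem_rcons inE => /predU1P[-> //|/good].
- rewrite map_rcons rcons_uniq u_items andbT; split.
    by apply: contra e_take => /sub.
  move=> x; rewrite mem_rcons inE => /predU1P[->|/sub/subS //].
  by rewrite (take_nth e0) // mem_rcons mem_head.
Qed.

Definition parent_cost := (cost (Bin Lt (Reg 2) (Reg 1)) + max_time (parent_step k)).+1.
Definition edge_cost := (cost (Reg 0) + max_time (edge_step k)).+1.

Lemma run_cycle_finder : exists s t items,
  [/\ exec b (cycle_finder k) (init_state (encode_input T r fs)) s t,
    t <= 100 + n.+1 * parent_cost + (size fs).+1 * edge_cost,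
    output s = flatten (map (@encode_item n m) items)
      /\ size fs <= (#|L| + m) * B + size items,
    forall it, it \in items -> good_item k T F it
    & uniq (map fst items)].
Proof.
have lt_1 := word_gt1 word_large k_gt1.
have lt_n : n < 2 ^ b.
  apply: leq_trans word_large; apply: leq_trans (leq_pmull _ _) => //.
  by rewrite ltnS leq_addr.
have lf0 : loop_free prologue by [].
have [t0 ex0 le_t0] := exec_run b (init_state (encode_input T r fs)) lf0.
set s0 := run _ _ _ in ex0.
have Inp : encode_input T r fs
  = [:: n, m, size fs, val r & parent_list ++ edge_list fs] by [].
have start : parents_read 0 s0.
  rewrite /s0 Inp /=; split=> //=.
  - by rewrite /upd /= !word_small.
  - by rewrite /upd /= /eval word_small //; apply: ltn_trans lt_1.
  - by rewrite drop0.
have stop1 s : parents_read n s -> eval b s (Bin Lt (Reg 2) (Reg 1)) = 0.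
  case=> [[_ R1] R2 _ _ _]; rewrite /eval /= R1 R2 ltnn word_small //.
  exact: ltn_trans lt_1.
have lf1 : loop_free (parent_step k) by [].
have [s1 [t1 [ex1 /edges_read_start I1 le_t1]]] :=
  exec_while lf1 start parents_read_step stop1.
have stop2 s : edges_read (size fs) s -> eval b s (Reg 0) = 0.
  by case=> items [_ [R0 _] _ _ _]; rewrite /eval R0 subnn.
have [s2 [t2 [ex2 [items [_ _ [O2 cnt] good [u_items _]]] le_t2]]] :=
  exec_while (loop_free_edge_step k) I1 edges_read_step stop2.
exists s2, (t0 + (t1 + t2).+1).+1, items; split=> //.
- exact: exec_seq ex0 (exec_seq ex1 ex2).
(* The summand 100 covers the prologue and the sequencing. *)
- by move: le_t0 le_t1 le_t2; rewrite /parent_cost /edge_cost /=; lia.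
split=> //; apply: leq_trans cnt _; rewrite leq_add2r.
exact: filled_cells_le.
Qed.

End Program.

(** * From the count to the final bounds *)

Lemma edge_of_inj n m : injective (@edge_of n m).
Proof.
move=> [u w] [u' w'] E.
have: inl u \in edge_of (u', w') by rewrite -E !inE eqxx.
have: inr w \in edge_of (u', w') by rewrite -E !inE eqxx orbT.
by rewrite !inE => /orP[//|/eqP[->]] /orP[/eqP[->]|].
Qed.

Lemma record_size_le k : 0 < k -> record_size k <= 6 * k ^ 3.
Proof. by rewrite /record_size /slots /table_size expnS => k0; nia. Qed.

Theorem theorem9p4 :
  exists c : nat, forall k : nat, 2 <= k ->
  exists (p : cmd) (c1 c2 : nat),
  forall (n m h : nat) (T : rel 'I_n) (r : 'I_n) (F : {set 'I_n * 'I_m})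
         (fs : seq ('I_n * 'I_m)) (b : nat),
    is_tree T -> height T r = h -> h < k ->
    (forall v : 'I_n, v \in leaves T r -> depth T r v = h) ->
    F \subset setX (leaves T r) [set: 'I_m] -> m <= n ->
    perm_eq fs (enum F) ->
    c2 * (n + #|F|) <= 2 ^ b ->
  exists (out : seq nat) (t : nat)
         (X : {set {set vertex n m} * {set {set vertex n m}}}),
    [/\ computes b p (encode_input T r fs) out t,
        t <= c1 * (#|F| * trunc_log 2 n + n),
        lists (2 * k) out X,
        (forall (e : {set vertex n m}) (C : {set {set vertex n m}}),
           (e, C) \in X ->
           [/\ e \in [set edge_of f | f in F],
               is_cycle (union_graph T F) (2 * k) C
             & e \in C])
      & (#|F|%:R / k%:R - c%:R * (k%:R ^+ 2 * (#|leaves T r| + m)%:R)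
           <= #|X|%:R :> rat)%R].
Proof.
(* The 6 is that of [record_size_le]; the factors 2 in [K] absorb the [.+1] in the numbers of
   rounds, as [n] is positive. *)
exists 6 => k k_gt1; pose K := 100 + 2 * parent_cost k + 2 * edge_cost k.
(* The outer 2 comes from [le_e], and the 3 from [n + m + 1 <= 3 * n]. *)
exists (cycle_finder k), (2 * K), (3 * record_size k).
move=> n m h T r F fs b [symT _ connT _] _ lt_hk leaf_depth F_sub le_mn fs_F large.
have n_gt0 : 0 < n by apply: leq_ltn_trans (ltn_ord r).
have size_fs : size fs = #|F| by rewrite (perm_size fs_F) cardE.
have B_gt0 : 0 < record_size k by [].
have word_large : record_size k * (n + m).+1 <= 2 ^ b.
  apply: leq_trans large; rewrite [3 * _]mulnC -mulnA leq_mul2l; apply/orP; right.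
  by clear -le_mn n_gt0; lia.
have size_word : size fs < 2 ^ b.
  apply: leq_trans large; rewrite -mulnA [record_size k * _]mulnC mulnA.
  apply: leq_trans (leq_pmulr _ B_gt0); rewrite size_fs.
  by clear -n_gt0; lia.
have [s [t [items [ex le_t [out_s cnt] good u_items]]]] :=
  run_cycle_finder word_large size_word lt_hk k_gt1 symT connT leaf_depth F_sub fs_F.
have u_den : uniq (map (@denote_item n m) items).
  apply: (@map_uniq _ _ fst); rewrite -map_comp.
  by rewrite (map_comp (@edge_of n m) fst) (map_inj_uniq (@edge_of_inj n m)).
exists (output s), t, [set x in map (@denote_item n m) items]; split.
- by exists s.
- apply: leq_trans le_t _; rewrite size_fs.
  have le_e : n + #|F| <= 2 * (#|F| * trunc_log 2 n + n).
    case: (ltnP 1 n) => [n_gt1|n_le1].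
      have log_gt0 : 0 < trunc_log 2 n by rewrite trunc_log_gt0.
      by have := leq_pmulr #|F| log_gt0; clear; lia.
    (* For [n = 1] the logarithm vanishes, but [F] has at most [n * m <= 1] edges. *)
    have : #|F| <= 1.
      apply: leq_trans (max_card _) _; rewrite card_prod !card_ord.
      by clear -n_le1 le_mn; nia.
    by clear -n_gt0; lia.
  rewrite [2 * K]mulnC -mulnA.
  apply: (@leq_trans (K * (n + #|F|))); last first.
    by rewrite leq_mul2l le_e orbT.
  by rewrite /K; clear -n_gt0; nia.
- exists items; split=> //.
  by apply/allP => it /good[_ -> _ _ _].
- move=> e C; rewrite inE => /mapP[it /good[itF sz cyc u_it e_in] [-> ->]]; split=> //.
    exact: imset_f.
  by split; [clear -k_gt1; lia | exists it.2].
have card_X : #|[set x in map (@denote_item n m) items]| = size items.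
  by rewrite cardsE (card_uniqP u_den) size_map.
rewrite card_X -size_fs.
have k_gt0 : 0 < k by apply: ltnW.
(* One factor [k] of [6 * k ^ 3] is split off, and the number of items is at most [k] times
   itself. *)
have bound : size fs <= (size items + 6 * (k ^ 2 * (#|leaves T r| + m))) * k.
  apply: leq_trans cnt _; rewrite addnC [leqRHS]mulnDl leq_add ?leq_pmulr //.
  apply: leq_trans (leq_mul (leqnn _) (record_size_le k_gt0)) _.
  by rewrite !expnS expn0; clear; nia.
rewrite lerBlDr ler_pdivrMr ?ltr0n // -natrX -!natrM -natrD -natrM ler_nat.
exact: bound.
Qed.
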